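(* Let $(A,\succ,\prec)$ be an anti-dendriform algebra and $r=\sum_i a_i\otimes b_i\in A\otimes A$. Let $\Delta_{\succ,r},\Delta_{\prec,r}:A\to A\otimes A$ be given by $$\Delta_{\succ,r}(x)=-(R_{\prec}(x)\otimes I+I\otimes L_{\cdot}(x))r,\qquad \Delta_{\prec,r}(x)=(R_{\cdot}(x)\otimes I+I\otimes L_{\succ}(x))r .$$ If $r$ is a solution of the anti-dendriform Yang-Baxter equation (AD-YBE) in $(A,\succ,\prec)$ and $r+\tau(r)$ is invariant, then $(A,\succ,\prec,\Delta_{\succ,r},\Delta_{\prec,r})$ is an anti-dendriform bialgebra.
   Context: All vector spaces are finite-dimensional over a field $k$. An anti-dendriform algebra is a vector space $A$ with bilinear operations $\succ,\prec$ such that, writing $x\cdot y=x\succ y+x\prec y$, for all $x,y,z$: $x\succ(y\succ z)=-(x\cdot y)\succ z=-x\prec(y\cdot z)=(x\prec y)\prec z$ and $(x\succ y)\prec z=x\succ(y\prec z)$; then $(A,\cdot)$ is associative. For $\ast\in\{\succ,\prec,\cdot\}$: $L_\ast(x)y=x\ast y$, $R_\ast(x)y=y\ast x$. $\tau$ is the flip $\tau(a\otimes b)=b\otimes a$; $I$ is the identity. Invariance: $s\in A\otimes A$ is invariant if $(R_{\prec}(x)\otimes I+I\otimes L_{\cdot}(x))s=0$ and $(R_{\cdot}(x)\otimes I+I\otimes L_{\succ}(x))s=0$ for all $x\in A$. AD-YBE: for $r=\sum_i a_i\otimes b_i$, the equation $r_{12}\cdot r_{13}+r_{23}\succ r_{12}-r_{13}\prec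 r_{23}=0$ in $A\otimes A\otimes A$, where $r_{12}\cdot r_{13}=\sum_{i,j}a_i\cdot a_j\otimes b_i\otimes b_j$, $r_{23}\succ r_{12}=\sum_{i,j}a_j\otimes (a_i\succ b_j)\otimes b_i$, $r_{13}\prec r_{23}=\sum_{i,j}a_i\otimes a_j\otimes (b_i\prec b_j)$. Anti-dendriform bialgebra: a quintuple $(A,\succ,\prec,\Delta_\succ,\Delta_\prec)$ where $(A,\succ,\prec)$ is an anti-dendriform algebra; $\Delta_\succ,\Delta_\prec:A\to A\otimes A$ are linear maps forming an anti-dendriform coalgebra, i.e. the operations on $A^*$ defined by $\langle x,\zeta\succ_{A^*}\eta\rangle=\langle\Delta_\succ(x),\zeta\otimes\eta\rangle$, $\langle x,\zeta\prec_{A^*}\eta\rangle=\langle\Delta_\prec(x),\zeta\otimes\eta\rangle$ make $A^*$ an anti-dendriform algebra; and, with $\Delta=\Delta_\succ+\Delta_\prec$, for all $x,y\in A$: (1) $\Delta_{\prec}(x\cdot y)=(R_{\cdot}(y)\otimes I)\Delta_{\prec}(x)-(I\otimes L_{\succ}(x))\Delta_{\prec}(y)$; (2) $\Delta_{\succ}(x\cdot y)=(I\otimes L_{\cdot}(x))\Delta_{\succ}(y)-(R_{\prec}(y)\otimes I)\Delta_{\succ}(x)$; (3) $\Delta(x\prec y)=(R_{\prec}(y)\otimes I)\Delta(x)-(I\otimes L_{\prec}(x))\Delta_{\succ}(y)$; (4) $\Delta(x\succ y)=(I\otimes L_{\succ}(x))\Delta(y)-(R_{\succ}(y)\otimes I)\Delta_{\prec}(x)$;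 (5) $(L_{\succ}(x)\otimes I)\Delta(y)+(R_{\succ}(y)\otimes I)\tau\Delta_{\succ}(x)-(I\otimes L_{\prec}(y))\tau\Delta_{\prec}(x)-(I\otimes R_{\prec}(x))\Delta(y)=0$; (6) $(I\otimes R_{\cdot}(y))\Delta_{\succ}(x)+(L_{\succ}(y)\otimes I)\Delta_{\succ}(x)-\tau(I\otimes R_{\prec}(x))\Delta_{\prec}(y)-\tau(L_{\cdot}(x)\otimes I)\Delta_{\prec}(y)=0$. *)

(* Defs.v *)
From HB Require Import structures.
From mathcomp Require Import all_boot all_order all_algebra.

Set Implicit Arguments.
Unset Strict Implicit.
Unset Printing Implicit Defensive.

Import GRing.Theory.
Local Open Scope ring_scope.

Notation is_bilinear f := (bilinear_for *:%R *:%R f).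

(* The tensor product of two finite-dimensional spaces is modelled by the      *)
(* matrices of coefficients in the coordinate bases; [tlift_tens] and          *)
(* [tlift_uniq] are its universal property, so the choice of bases is          *)
(* immaterial.                                                                 *)
Section TensorProduct.
Variable k : fieldType.

Definition tensor (U V : vectType k) : vectType k :=
  'M[k]_(\dim {:U}, \dim {:V}).

Definition bvec (U : vectType k) (i : 'I_(\dim {:U})) : U :=
  (vbasis {:U})`_i.
Definition bcoord (U : vectType k) (u : U) (i : 'I_(\dim {:U})) : k :=
  coord (vbasis {:U}) i u.

Definition tens (U V : vectType k) (u : U) (v : V) : tensor U V :=
  \matrix_(i, j) (bcoord u i * bcoord v j).

(* The linear map induced by a bilinear map [b] (meaningless if [b] is not     *)
(* bilinear).                                                                  *)
Definition tlift (U V W : vectType k) (b : U -> V -> W) (t : tensor U V) : W :=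
  \sum_i \sum_j (t : 'M[k]_(_, _)) i j *: b (bvec i) (bvec j).

Definition tmap (U V U' V' : vectType k) (f : U -> U') (g : V -> V') :
    tensor U V -> tensor U' V' :=
  tlift (fun u v => tens (f u) (g v)).

Definition tflip (U V : vectType k) : tensor U V -> tensor V U :=
  tlift (fun u v => tens v u).

Definition dual_space (U : vectType k) : vectType k := 'Hom(U, k^o).

Definition tpair (U V : vectType k) (zeta : dual_space U) (eta : dual_space V) :
    tensor U V -> k^o :=
  tlift (fun u v => zeta u * eta v : k^o).

End TensorProduct.

Notation "U \ot V" := (tensor U V) (at level 40, left associativity) : type_scope.
Notation "u \ot v" := (tens u v) (at level 40, left associativity) : ring_scope.
Notation "f \otf g" := (tmap f g) (at level 40, left associativity) : ring_scope.

Section TensorTheory.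
Variable k : fieldType.
Implicit Types U V W : vectType k.

Lemma bvec_sum U (u : U) : u = \sum_i bcoord u i *: bvec i.
Proof.
exact/coord_vbasis/memvf.
Qed.

Lemma tens_bilinear U V : is_bilinear (@tens k U V).
Proof.
split=> [v a u u' | u a v v']; apply/matrixP=> i j; rewrite !mxE /bcoord linearP.
  by rewrite /= mulrDl mulrA.
by rewrite /= mulrDr mulrCA.
Qed.

HB.instance Definition _ U V :=
  bilinear_isBilinear.Build k U V (tensor U V) *:%R *:%R (@tens k U V)
    (@tens_bilinear U V).

Lemma tens_sum U V (t : U \ot V) :
  t = \sum_i \sum_j (t : 'M[k]_(_, _)) i j *: (bvec i \ot bvec j).
Proof.
rewrite [LHS]matrix_sum_delta; apply: eq_bigr => i _; apply: eq_bigr => j _.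
congr (_ *: _); apply/matrixP=> i' j'; rewrite !mxE /bcoord /bvec.
rewrite !coord_free ?(basis_free (vbasisP _)) // -natrM mulnb.
by rewrite eq_sym (eq_sym j).
Qed.

Lemma tlift_linear U V W (b : U -> V -> W) : linear (tlift b).
Proof.
move=> a t t'; rewrite /tlift scaler_sumr -big_split; apply: eq_bigr => i _ /=.
rewrite scaler_sumr -big_split; apply: eq_bigr => j _ /=.
by rewrite !mxE scalerDl scalerA.
Qed.

HB.instance Definition _ U V W (b : U -> V -> W) :=
  GRing.isLinear.Build k (tensor U V) W *:%R (tlift b) (tlift_linear b).
HB.instance Definition _ U V U' V' (f : U -> U') (g : V -> V') :=
  GRing.isLinear.Build k (tensor U V) (tensor U' V') *:%R (tmap f g)
    (tlift_linear _).
HB.instance Definition _ U V :=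
  GRing.isLinear.Build k (tensor U V) (tensor V U) *:%R (@tflip k U V)
    (tlift_linear _).
HB.instance Definition _ U V (zeta : dual_space U) (eta : dual_space V) :=
  GRing.isLinear.Build k (tensor U V) (k^o) *:%R (tpair zeta eta)
    (tlift_linear _).

Lemma tlift_tens U V W (b : U -> V -> W) (u : U) (v : V) :
  is_bilinear b -> tlift b (u \ot v) = b u v.
Proof.
move=> bb; pose B := GRing.isLinear.Build k U W *:%R _ (bb.1 v).
pose f : {linear U -> W} := HB.pack (b^~ v) B.
rewrite -[RHS]/(f u) [in RHS](bvec_sum u) linear_sum; apply: eq_bigr => i _.
pose C := GRing.isLinear.Build k V W *:%R _ (bb.2 (bvec i)).
pose g : {linear V -> W} := HB.pack (b (bvec i)) C.
rewrite linearZ /= -[b _ v]/(g v) [in RHS](bvec_sum v) linear_sum scaler_sumr.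
by apply: eq_bigr => j _; rewrite linearZ /= scalerA !mxE.
Qed.

Lemma tlift_uniq U V W (f g : {linear (U \ot V)%type -> W}) :
  (forall u v, f (u \ot v) = g (u \ot v)) -> f =1 g.
Proof.
move=> fg t; rewrite (tens_sum t) !linear_sum; apply: eq_bigr => i _.
by rewrite !linear_sum; apply: eq_bigr => j _; rewrite !linearZ /= fg.
Qed.

Lemma tmap_tens U V U' V' (f : U -> U') (g : V -> V') u v :
  linear f -> linear g -> (f \otf g) (u \ot v) = f u \ot g v.
Proof.
move=> lf lg; apply: (tlift_tens (b := fun u v => f u \ot g v)).
split=> [y a x x' | x a y y'] /=.
  by rewrite lf linearPl.
by rewrite lg linearPr.
Qed.

Lemma tflip_tens U V (u : U) (v : V) : tflip (u \ot v) = v \ot u.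
Proof.
apply: (tlift_tens (b := fun u v => v \ot u)).
by split=> [y a x x' | x a y y'] /=; rewrite ?linearPr ?linearPl.
Qed.

Lemma tpair_tens U V (zeta : dual_space U) (eta : dual_space V) (u : U) (v : V) :
  tpair zeta eta (u \ot v) = zeta u * eta v.
Proof.
apply: (tlift_tens (b := fun u v => zeta u * eta v : k^o)).
split=> [y a x x' | x a y y'] /=; rewrite linearP /=.
  by rewrite mulrDl /GRing.scale /= mulrA.
by rewrite mulrDr /GRing.scale /= mulrCA.
Qed.

End TensorTheory.

Section AntiDendriform.
Variable k : fieldType.

Definition Lop (A : Type) (op : A -> A -> A) (x : A) : A -> A :=
  fun y => op x y.
Definition Rop (A : Type) (op : A -> A -> A) (x : A) : A -> A :=
  fun y => op y x.

Definition dot (A : vectType k) (succ prec : A -> A -> A) : A -> A -> A :=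
  fun x y => succ x y + prec x y.

Record anti_dendriform_algebra (A : vectType k) (succ prec : A -> A -> A) :
    Prop := AntiDendriformAlgebra {
  ad_succ_bilinear : is_bilinear succ;
  ad_prec_bilinear : is_bilinear prec;
  ad_succ_succ : forall x y z,
    succ x (succ y z) = - succ (dot succ prec x y) z;
  ad_succ_dot : forall x y z,
    - succ (dot succ prec x y) z = - prec x (dot succ prec y z);
  ad_prec_dot : forall x y z,
    - prec x (dot succ prec y z) = prec (prec x y) z;
  ad_succ_prec : forall x y z,
    prec (succ x y) z = succ x (prec y z)
}.

(* The operation on the dual with <x, zeta * eta> = <D x, zeta (x) eta>; for   *)
(* linear [D] this is [dual_opE].                                              *)
Definition dual_op (A : vectType k) (D : A -> A \ot A) :
    dual_space A -> dual_space A -> dual_space A :=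
  fun zeta eta => linfun (fun x => tpair zeta eta (D x)).

Lemma dual_opE (A : vectType k) (D : A -> A \ot A) zeta eta x :
  linear D -> dual_op D zeta eta x = tpair zeta eta (D x).
Proof.
move=> lD; have lf : linear (fun x => tpair zeta eta (D x)).
  by move=> a y z; rewrite lD linearP.
pose B := GRing.isLinear.Build k A (k^o) *:%R _ lf.
pose f : {linear A -> k^o} := HB.pack (fun x => tpair zeta eta (D x)) B.
exact: (lfunE f).
Qed.

Lemma dotA (A : vectType k) (succ prec : A -> A -> A) :
  anti_dendriform_algebra succ prec -> associative (dot succ prec).
Proof.
case=> bs bp h1 h2 h3 h4 x y z.
have sE a b c : succ a (b + c) = succ a b + succ a c.
  by have := bs.2 a 1 b c; rewrite /= !scale1r.
have pE a b c : prec (a + b) c = prec a c + prec b c.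
  by have := bp.1 c 1 a b; rewrite /= !scale1r.
have S1 : succ (dot succ prec x y) z = - succ x (succ y z).
  by rewrite h1 opprK.
have P1 : prec x (dot succ prec y z) = - succ x (succ y z).
  by rewrite h1 h2 opprK.
have Q1 : prec (prec x y) z = succ x (succ y z) by rewrite -h3 P1 opprK.
transitivity (succ x (dot succ prec y z) + prec x (dot succ prec y z)) => //.
transitivity (succ (dot succ prec x y) z + prec (dot succ prec x y) z) => //.
by rewrite S1 P1 /dot sE pE Q1 h4 addrAC subrr add0r addrCA addNr addr0.
Qed.

Record anti_dendriform_coalgebra (A : vectType k)
    (Dsucc Dprec : A -> A \ot A) : Prop := AntiDendriformCoalgebra {
  adc_succ_linear : linear Dsucc;
  adc_prec_linear : linear Dprec;
  adc_dual : anti_dendriform_algebra (dual_op Dsucc) (dual_op Dprec)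
}.

Record anti_dendriform_bialgebra (A : vectType k) (succ prec : A -> A -> A)
    (Dsucc Dprec : A -> A \ot A) : Prop := AntiDendriformBialgebra {
  adb_algebra : anti_dendriform_algebra succ prec;
  adb_coalgebra : anti_dendriform_coalgebra Dsucc Dprec;
  adb_compat :
    let I : A -> A := idfun in
    let mul := dot succ prec in
    let D x := Dsucc x + Dprec x in
    forall x y : A,
    [/\ Dprec (mul x y)
          = (Rop mul y \otf I) (Dprec x) - (I \otf Lop succ x) (Dprec y),
        Dsucc (mul x y)
          = (I \otf Lop mul x) (Dsucc y) - (Rop prec y \otf I) (Dsucc x),
        D (prec x y)
          = (Rop prec y \otf I) (D x) - (I \otf Lop prec x) (Dsucc y)
      & D (succ x y)
          = (I \otf Lop succ x) (D y) - (Rop succ y \otf I) (Dprec x)]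
    /\
    [/\ (Lop succ x \otf I) (D y) + (Rop succ y \otf I) (tflip (Dsucc x))
          - (I \otf Lop prec y) (tflip (Dprec x)) - (I \otf Rop prec x) (D y)
          = 0
      & (I \otf Rop mul y) (Dsucc x) + (Lop succ y \otf I) (Dsucc x)
          - tflip ((I \otf Rop prec x) (Dprec y))
          - tflip ((Lop mul x \otf I) (Dprec y))
          = 0]
}.

Definition ad_invariant (A : vectType k) (succ prec : A -> A -> A)
    (s : A \ot A) : Prop :=
  forall x : A,
    (Rop prec x \otf idfun) s + (idfun \otf Lop (dot succ prec) x) s = 0 /\
    (Rop (dot succ prec) x \otf idfun) s + (idfun \otf Lop succ x) s = 0.

(* For bilinear [F], the sum over i, j of F a_i b_i a_j b_j for any            *)
(* decomposition r = sum_i a_i (x) b_i; see [tlift2_sum].                      *)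
Definition tlift2 (A W : vectType k) (F : A -> A -> A -> A -> W)
    (r : A \ot A) : W :=
  tlift (fun ai bi => tlift (fun aj bj => F ai bi aj bj) r) r.

Definition AD_YBE (A : vectType k) (succ prec : A -> A -> A)
    (r : A \ot A) : Prop :=
  let r12_dot_r13 :=
    tlift2 (fun ai bi aj bj => dot succ prec ai aj \ot bi \ot bj) r in
  let r23_succ_r12 :=
    tlift2 (fun ai bi aj bj => aj \ot succ ai bj \ot bi) r in
  let r13_prec_r23 :=
    tlift2 (fun ai bi aj bj => ai \ot aj \ot prec bi bj) r in
  r12_dot_r13 + r23_succ_r12 - r13_prec_r23 = 0.

Definition Dsucc_r (A : vectType k) (succ prec : A -> A -> A) (r : A \ot A) :
    A -> A \ot A :=
  fun x => - ((Rop prec x \otf idfun) r + (idfun \otf Lop (dot succ prec) x) r).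

Definition Dprec_r (A : vectType k) (succ prec : A -> A -> A) (r : A \ot A) :
    A -> A \ot A :=
  fun x => (Rop (dot succ prec) x \otf idfun) r + (idfun \otf Lop succ x) r.

Lemma tlift2_sum (A W : vectType k) (F : A -> A -> A -> A -> W)
    (n : nat) (a b : 'I_n -> A) :
  (forall x y, is_bilinear (F x y)) ->
  (forall x y, is_bilinear (fun u v => F u v x y)) ->
  tlift2 F (\sum_i a i \ot b i) = \sum_i \sum_j F (a i) (b i) (a j) (b j).
Proof.
move=> F1 F2; rewrite /tlift2 linear_sum; apply: eq_bigr => i _.
rewrite /= tlift_tens; last first.
  split=> [y c x x' | x c y y'].
    rewrite !linear_sum /= scaler_sumr -big_split; apply: eq_bigr => j _ /=.
    by rewrite !tlift_tens // (F2 _ _).1.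
  rewrite !linear_sum /= scaler_sumr -big_split; apply: eq_bigr => j _ /=.
  by rewrite !tlift_tens // (F2 _ _).2.
by rewrite linear_sum; apply: eq_bigr => j _; rewrite /= tlift_tens.
Qed.

Lemma AD_YBE_sum (A : vectType k) (succ prec : A -> A -> A)
    (n : nat) (a b : 'I_n -> A) :
  is_bilinear succ -> is_bilinear prec ->
  AD_YBE succ prec (\sum_i a i \ot b i) <->
  \sum_i \sum_j dot succ prec (a i) (a j) \ot b i \ot b j
  + \sum_i \sum_j a j \ot succ (a i) (b j) \ot b i
  - \sum_i \sum_j a i \ot a j \ot prec (b i) (b j) = 0.
Proof.
move=> bs bp.
have bd : is_bilinear (dot succ prec).
  by split=> [y c x x' | x c y y']; rewrite /dot /= ?(bs.1, bp.1, bs.2, bp.2)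
    scalerDr addrACA.
rewrite /AD_YBE !tlift2_sum // => x y; split=> [u c v w | u c v w] /=;
  by rewrite ?(bs.1, bs.2, bp.1, bp.2, bd.1, bd.2) ?(linearPl, linearPr).
Qed.

End AntiDendriform.

(* Main.v *)
(* Pairing with linear forms turns every identity between tensors into a      *)
(* scalar one. Writing r = sum a (x) b, an identity in A (x) A becomes a      *)
(* single contraction against r, and one in A (x) A (x) A a double            *)
(* contraction, in which the two copies (a, b), (a', b') of r may be          *)
(* exchanged. Of the bialgebra conditions, (1)-(4) hold for every r, while    *)
(* (5) and (6) follow from the invariance of s = r + tau(r). For the          *)
(* coalgebra axioms, substitute b (x) a = s - a (x) b in the AD-YBE: all the  *)
(* terms containing s cancel by invariance, so that two rotated forms of the  *)
(* equation hold too. The difference of the two sides of each axiom is        *)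
(* obtained from these three equations by letting x act on the first and on   *)
(* the third factor.                                                          *)

From HB Require Import structures.
Require Import Defs.
From mathcomp Require Import all_boot all_order all_algebra.
From mathcomp Require Import ring.
Import GRing.Theory.
Local Open Scope ring_scope.

Set Implicit Arguments.
Unset Strict Implicit.
Unset Printing Implicit Defensive.

(** Each condition is tested against linear forms, which turns it into a scalar identity in the legs
    of r. For (1)-(4) the two sides agree termwise ([coproduct_mul]). The left sides of (5) and (6)
    are multiplication operators applied to an invariance identity of s ([coproduct_flip]).

    The main work is the coalgebra axioms. Evaluated at x, the defect of each is quadratic in r and
    equals x acting, by multiplications on the first and third factors, on the equations [ybe],
    [ybe_rot], [ybe_rot2] in A ⊗ A ⊗ A. The last two are cyclic rotations of the AD-YBE in which
    invariance allows the legs of r to be swapped. [eq_contract2] reduces such an equality to a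
    pointwise one up to exchange of the two copies of r, and [triple_normal] with [ring] decides
    what is left. *)

Section Contraction.
Variables (k : fieldType) (A : vectType k).
Implicit Types (phi psi : A -> A -> k) (t : A \ot A).

(** The sum runs over basis vectors, so additivity in [phi] holds for arbitrary functions;
    bilinearity matters only for evaluating on pure tensors. The value lies in [k] rather than [k^o]
    so that [ring] applies. *)
Definition contract phi t : k := tlift (phi : A -> A -> k^o) t.

Lemma contractE phi t :
  contract phi t
    = \sum_i \sum_j (t : 'M[k]_(_, _)) i j * phi (bvec i) (bvec j).
Proof. by []. Qed.

Lemma eq_contract phi psi t :
  (forall u v, phi u v = psi u v) -> contract phi t = contract psi t.
Proof.
move=> e; rewrite !contractE; apply: eq_bigr => i _.
by apply: eq_bigr => j _; rewrite e.
Qed.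

Lemma contractD phi psi t :
  contract phi t + contract psi t = contract (fun u v => phi u v + psi u v) t.
Proof.
rewrite !contractE -big_split; apply: eq_bigr => i _ /=.
by rewrite -big_split; apply: eq_bigr => j _ /=; rewrite mulrDr.
Qed.

Lemma contractZ c phi t :
  c * contract phi t = contract (fun u v => c * phi u v) t.
Proof.
rewrite !contractE mulr_sumr; apply: eq_bigr => i _.
by rewrite mulr_sumr; apply: eq_bigr => j _; rewrite mulrCA.
Qed.

Lemma contractN phi t : - contract phi t = contract (fun u v => - phi u v) t.
Proof.
by rewrite -mulN1r contractZ; apply: eq_contract => u v; rewrite mulN1r.
Qed.

Lemma contract_eq0 phi t : (forall u v, phi u v = 0) -> contract phi t = 0.
Proof.
move=> e; rewrite contractE big1 // => i _.
by rewrite big1 // => j _; rewrite e mulr0.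
Qed.

Lemma contract_exchange (F : A -> A -> A -> A -> k) t t' :
  contract (fun a b => contract (F a b) t') t
    = contract (fun a' b' => contract (fun a b => F a b a' b') t) t'.
Proof.
transitivity (\sum_i \sum_j \sum_i' \sum_j' (t : 'M[k]_(_, _)) i j *
  ((t' : 'M[k]_(_, _)) i' j' * F (bvec i) (bvec j) (bvec i') (bvec j'))).
  rewrite contractE; apply: eq_bigr => i _; apply: eq_bigr => j _.
  rewrite contractE mulr_sumr; apply: eq_bigr => i' _.
  by rewrite mulr_sumr.
rewrite contractE; under eq_bigr => i _ do rewrite exchange_big /=.
rewrite exchange_big /=; apply: eq_bigr => i' _.
under eq_bigr => i _ do rewrite exchange_big /=.
transitivity (\sum_i \sum_j' \sum_j (t : 'M[k]_(_, _)) i j *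
  ((t' : 'M[k]_(_, _)) i' j' * F (bvec i) (bvec j) (bvec i') (bvec j'))).
  by apply: eq_bigr => i _; rewrite exchange_big.
rewrite exchange_big; apply: eq_bigr => j' _.
rewrite contractE mulr_sumr; apply: eq_bigr => i _.
by rewrite mulr_sumr; apply: eq_bigr => j _; rewrite mulrCA.
Qed.

Lemma linear_tlift (W : vectType k) (h : {linear W -> k^o}) (b : A -> A -> W)
    t :
  h (tlift b t) = contract (fun u v => h (b u v)) t.
Proof.
rewrite linear_sum; apply: eq_bigr => i _; rewrite linear_sum.
by apply: eq_bigr => j _; rewrite linearZ.
Qed.

Definition biscalar_form phi :=
  (forall v c u u', phi (c *: u + u') v = c * phi u v + phi u' v) /\
  (forall u c v v', phi u (c *: v + v') = c * phi u v + phi u v').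

Lemma contract_tens phi u v :
  biscalar_form phi -> contract phi (u \ot v) = phi u v.
Proof.
case=> l1 l2; apply: (@tlift_tens _ _ _ k^o phi).
by split=> ? ? ? ? /=; rewrite ?l1 ?l2.
Qed.

Lemma contract_tlift phi (b : A -> A -> A \ot A) t :
  contract phi (tlift b t) = contract (fun u v => contract phi (b u v)) t.
Proof. exact: (linear_tlift (tlift (phi : A -> A -> k^o))). Qed.

Lemma contract_tmap phi (f g : A -> A) t : biscalar_form phi ->
  contract phi ((f \otf g) t) = contract (fun u v => phi (f u) (g v)) t.
Proof.
move=> lphi; rewrite contract_tlift; apply: eq_contract => u v.
by rewrite contract_tens.
Qed.

Lemma contract_tflip phi t : biscalar_form phi ->
  contract phi (tflip t) = contract (fun u v => phi v u) t.
Proof.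
move=> lphi; rewrite contract_tlift; apply: eq_contract => u v.
by rewrite contract_tens.
Qed.

Lemma contract_tensD phi t t' :
  contract phi (t + t') = contract phi t + contract phi t'.
Proof. exact: (linearD (tlift (phi : A -> A -> k^o))). Qed.

Lemma contract_tensN phi t : contract phi (- t) = - contract phi t.
Proof. exact: (linearN (tlift (phi : A -> A -> k^o))). Qed.

Lemma contract_tensZ phi c t : contract phi (c *: t) = c * contract phi t.
Proof. exact: (linearZ_LR (tlift (phi : A -> A -> k^o))). Qed.

Lemma contract_tens0 phi : contract phi 0 = 0.
Proof. exact: (linear0 (tlift (phi : A -> A -> k^o))). Qed.

(** Products of two coordinate forms read off the matrix entries, so products of linear forms
    separate tensors. *)
Lemma eq_tensor t t' :
  (forall zeta eta : {scalar A},
     contract (fun u v => zeta u * eta v) t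
       = contract (fun u v => zeta u * eta v) t') -> t = t'.
Proof.
have coordE i j (s : A \ot A) : (s : 'M[k]_(_, _)) i j
    = contract (fun u v => bcoord u i * bcoord v j) s.
  rewrite [in LHS](tens_sum s) summxE; apply: eq_bigr => i' _.
  by rewrite summxE; apply: eq_bigr => j' _; rewrite !mxE.
move=> e; apply/matrixP=> i j; rewrite !coordE.
exact: (e (coord (vbasis {:A}) i : {scalar A})
          (coord (vbasis {:A}) j : {scalar A})).
Qed.

(* [dual_space A] takes its values in [k^o]; [scal] retypes them in [k],      *)
(* where [ring] applies.                                                      *)
Definition scal (zeta : dual_space A) : A -> k := zeta.
Lemma scal_linear zeta : linear_for *%R (scal zeta).
Proof. by move=> c u v; rewrite /scal linearP. Qed.
HB.instance Definition _ zeta :=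
  GRing.isLinear.Build k A k *%R (scal zeta) (scal_linear zeta).

(** The pairing of t ⊗ t with [F]; the first two arguments are the legs of one copy, the last two
    those of the other. *)
Definition contract2 (F : A -> A -> A -> A -> k) t : k :=
  contract (fun a b => contract (F a b) t) t.

(* The right-hand side of the hypothesis is antisymmetric under the exchange  *)
(* of the two copies of [t], hence contracts to 0.                            *)
Lemma eq_contract2 F G K t :
  (forall a b a' b', F a b a' b' - G a b a' b' = K a b a' b' - K a' b' a b) ->
  contract2 F t = contract2 G t.
Proof.
move=> e; apply/eqP; rewrite -subr_eq0; apply/eqP.
transitivity (contract2 (fun a b a' b' => F a b a' b' - G a b a' b') t).
  rewrite /contract2 contractN contractD; apply: eq_contract => a b.
  by rewrite contractN contractD.
transitivity (contract2 K t - contract2 (fun a b a' b' => K a' b' a b) t).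
  rewrite /contract2 contractN contractD; apply: eq_contract => a b.
  by rewrite contractN contractD; apply: eq_contract => a' b'; rewrite e.
by rewrite {2}/contract2 contract_exchange subrr.
Qed.

Lemma contract2D F G t :
  contract2 F t + contract2 G t
    = contract2 (fun a b a' b' => F a b a' b' + G a b a' b') t.
Proof.
rewrite /contract2 contractD; apply: eq_contract => a b.
by rewrite contractD.
Qed.

Lemma contract2N F t :
  - contract2 F t = contract2 (fun a b a' b' => - F a b a' b') t.
Proof.
rewrite /contract2 contractN; apply: eq_contract => a b.
by rewrite contractN.
Qed.

Definition triscalar_form (F : A -> A -> A -> k) :=
  [/\ forall v w c u u', F (c *: u + u') v w = c * F u v w + F u' v w,
      forall u w c v v', F u (c *: v + v') w = c * F u v w + F u v' w
    & forall u v c w w', F u v (c *: w + w') = c * F u v w + F u v w'].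

Definition contract3 (F : A -> A -> A -> k) (t : tensor (tensor A A) A) : k :=
  tlift (fun p w => contract (fun u v => F u v w) p : k^o) t.

Lemma contract3_tens F u v w :
  triscalar_form F -> contract3 F (u \ot v \ot w) = F u v w.
Proof.
case=> F1 F2 F3; rewrite /contract3 tlift_tens.
  by rewrite contract_tens //; split=> *; rewrite (F1, F2).
split=> [w' c p p' | p c w' w''] /=.
  by rewrite contract_tensD contract_tensZ.
rewrite /GRing.scale /= contractZ contractD; apply: eq_contract => x y.
by rewrite F3.
Qed.

Lemma contract3_tlift2 F (G : A -> A -> A -> A -> tensor (tensor A A) A) t :
  contract3 F (tlift2 G t)
    = contract2 (fun a b a' b' => contract3 F (G a b a' b')) t.
Proof.
pose h := tlift (fun p w => contract (fun u v => F u v w) p : k^o).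
rewrite /tlift2 /contract3 (linear_tlift h); apply: eq_contract => a b.
exact: (linear_tlift h).
Qed.
End Contraction.

(** * Invariance and the three forms of the AD-YBE *)

Section Coboundary.
Variables (k : fieldType) (A : vectType k) (succ prec : {bilinear A -> A -> A}).
Hypothesis hA : anti_dendriform_algebra succ prec.
Variable r : A \ot A.
Hypotheses (hr : AD_YBE succ prec r)
  (hinv : ad_invariant succ prec (r + tflip r)).
Local Notation "x ≻ y" := (succ x y) (at level 40).
Local Notation "x ≺ y" := (prec x y) (at level 40).
Local Notation "x ∙ y" := (dot succ prec x y) (at level 40).

Lemma dot_bilinear : is_bilinear (dot succ prec).
Proof.
by split=> [y c x x' | x c y y'];
  rewrite /dot /= ?linearPl ?linearPr scalerDr addrACA.
Qed.
HB.instance Definition _ :=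
  bilinear_isBilinear.Build k A A A *:%R *:%R (dot succ prec) dot_bilinear.

(** The last two terms are the contribution of tau(r), rewritten so that only r itself is
    contracted. *)
Lemma invariant_dot phi x : biscalar_form phi ->
  contract (fun u v => phi (u ≺ x) v + phi u (x ∙ v)
    + phi (v ≺ x) u + phi v (x ∙ u)) r = 0.
Proof.
move=> lphi; have := congr1 (contract phi) (hinv x).1.
have [l1 l2] := lphi.
rewrite contract_tensD !contract_tmap // contract_tens0 contractD => e.
rewrite -[RHS]e contract_tensD contract_tflip ?contractD.
  by apply: eq_contract => u v; rewrite !addrA.
by split=> *; rewrite /Rop /Lop /= ?(linearPl, linearPr) ?(l1, l2); ring.
Qed.

Lemma invariant_succ phi x : biscalar_form phi ->
  contract (fun u v => phi (u ∙ x) v + phi u (x ≻ v)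
    + phi (v ∙ x) u + phi v (x ≻ u)) r = 0.
Proof.
move=> lphi; have := congr1 (contract phi) (hinv x).2.
have [l1 l2] := lphi.
rewrite contract_tensD !contract_tmap // contract_tens0 contractD => e.
rewrite -[RHS]e contract_tensD contract_tflip ?contractD.
  by apply: eq_contract => u v; rewrite !addrA.
by split=> *; rewrite /Rop /Lop /= ?(linearPl, linearPr) ?(l1, l2); ring.
Qed.

(** The difference of the two invariance conditions, since u ∙ x - u ≺ x = u ≻ x and x ≻ v - x ∙ v =
    - (x ≺ v). *)
Lemma invariant_prec phi x : biscalar_form phi ->
  contract (fun u v => phi (u ≻ x) v - phi u (x ≺ v)
    + phi (v ≻ x) u - phi v (x ≺ u)) r = 0.
Proof.
move=> lphi; rewrite -[RHS](subrr 0) -{1}(invariant_succ x lphi).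
rewrite -(invariant_dot x lphi) contractN contractD.
case: lphi => l1 l2.
have D1 u u' v : phi (u + u') v = phi u v + phi u' v.
  by have := l1 v 1 u u'; rewrite scale1r mul1r.
have D2 u v v' : phi u (v + v') = phi u v + phi u v'.
  by have := l2 u 1 v v'; rewrite scale1r mul1r.
by apply: eq_contract => u v; rewrite /dot !(D1, D2); ring.
Qed.

Lemma ybe F : triscalar_form F ->
  contract2 (fun a b a' b' =>
    F (a ∙ a') b b' + F a' (a ≻ b') b - F a a' (b ≺ b')) r = 0.
Proof.
move=> lF; have := congr1 (contract3 F) hr.
have c3D t t' : contract3 F (t + t') = contract3 F t + contract3 F t'.
  exact: (linearD (tlift (fun p w => contract (fun u v => F u v w) p : k^o))).
have c3N t : contract3 F (- t) = - contract3 F t.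
  exact: (linearN (tlift (fun p w => contract (fun u v => F u v w) p : k^o))).
have c30 : contract3 F 0 = 0.
  exact: (linear0 (tlift (fun p w => contract (fun u v => F u v w) p : k^o))).
rewrite !c3D c3N c30 !contract3_tlift2 contract2N !contract2D => <-.
apply: eq_contract => a b; apply: eq_contract => a' b'.
by rewrite !contract3_tens.
Qed.

(** The AD-YBE with factors permuted cyclically ([Y]), corrected by invariance: [S1] uses it in the
    last two factors for the element b of the other copy, [S2] in the third and first factors for a.
    The result is [Y + S1 - S2]. *)
Lemma ybe_rot F : triscalar_form F ->
  contract2 (fun a b a' b' =>
    F a (a' ≺ b) b' + F a a' (b ∙ b') - F (a' ≻ a) b' b) r = 0.
Proof.
move=> [F1 F2 F3].
have Y : contract2 (fun a b a' b' => F b b' (a ∙ a')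
    + F (a ≻ b') b a' - F a' (b ≺ b') a) r = 0.
  by apply: (@ybe (fun p q s => F q s p)); split.
have S1 : contract2 (fun a b a' b' => F a (a' ≺ b) b' + F a a' (b ∙ b')
    + F a (b' ≺ b) a' + F a b' (b ∙ a')) r = 0.
  rewrite /contract2 contract_eq0 // => a b.
  by apply: (@invariant_dot (fun u v => F a u v) b); split.
have S2 : contract2 (fun a b a' b' => F b' b (a' ∙ a) + F (a ≻ b') b a'
    + F a' b (b' ∙ a) + F (a ≻ a') b b') r = 0.
  rewrite /contract2 contract_eq0 // => a b.
  by apply: (@invariant_succ (fun u v => F v b u) a); split.
apply: etrans (_ : _ = 0 + 0 - 0) _; last by rewrite subr0 addr0.
rewrite -[X in _ = X + _ - _]Y -[X in _ = _ + X - _]S1 -[X in _ = _ - X]S2.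
rewrite contract2N !contract2D.
(* The leftover terms cancel in pairs that match after exchanging the copies of r; [K] lists one
   term of each pair. *)
pose K a b a' b' := F a' (b ≺ b') a - F (a' ≻ a) b' b - F b b' (a ∙ a')
  - F a b' (b ∙ a').
by apply: (@eq_contract2 _ _ _ _ K) => a b a' b'; rewrite /K; ring.
Qed.

(** The same method with the other rotation: invariance is used in the first two factors ([S1]) and
    in the third and first ([S2]), giving [S1 + S2 - Y]. *)
Lemma ybe_rot2 F : triscalar_form F ->
  contract2 (fun a b a' b' =>
    F (a ≺ a') b b' + F a' (a ∙ b') b + F a a' (b ≻ b')) r = 0.
Proof.
move=> [F1 F2 F3].
have Y : contract2 (fun a b a' b' => F b' (a ∙ a') b
    + F b a' (a ≻ b') - F (b ≺ b') a a') r = 0.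
  by apply: (@ybe (fun p q s => F s p q)); split.
have S1 : contract2 (fun a b a' b' => F (a' ≺ a) b' b + F a' (a ∙ b') b
    + F (b' ≺ a) a' b + F b' (a ∙ a') b) r = 0.
  rewrite /contract2 contract_eq0 // => a b.
  by apply: (@invariant_dot (fun u v => F u v b) a); split.
have S2 : contract2 (fun a b a' b' => F b' a (a' ≻ b) - F (b ≺ b') a a'
    + F a' a (b' ≻ b) - F (b ≺ a') a b') r = 0.
  rewrite /contract2 contract_eq0 // => a b.
  by apply: (@invariant_prec (fun u v => F v a u) b); split.
apply: etrans (_ : _ = 0 + 0 - 0) _; last by rewrite subr0 addr0.
rewrite -[X in _ = X + _ - _]S1 -[X in _ = _ + X - _]S2 -[X in _ = _ - X]Y.
rewrite contract2N !contract2D.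
pose K a b a' b' := F (a ≺ a') b b' + F a a' (b ≻ b') + F b a' (a ≻ b')
  + F (b ≺ a') a b'.
by apply: (@eq_contract2 _ _ _ _ K) => a b a' b'; rewrite /K; ring.
Qed.

(** * Normal form of triple products *)

Let succ_succE x y z : x ≻ (y ≻ z) = - ((x ∙ y) ≻ z).
Proof. exact: ad_succ_succ. Qed.
Let prec_dotE x y z : x ≺ (y ∙ z) = - (x ≻ (y ≻ z)).
Proof. by rewrite succ_succE (ad_succ_dot hA) !opprK. Qed.
Let prec_precl x y z : (x ≺ y) ≺ z = x ≻ (y ≻ z).
Proof. by rewrite succ_succE -(ad_prec_dot hA) -(ad_succ_dot hA). Qed.
Let succ_precA x y z : (x ≻ y) ≺ z = x ≻ (y ≺ z).
Proof. exact: ad_succ_prec. Qed.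
Let prec_succl x y z : (x ≺ y) ≻ z = - (x ≻ (y ≻ z)) - (x ≻ y) ≻ z.
Proof. by rewrite succ_succE opprK /dot linearDl addrAC subrr add0r. Qed.
Let prec_precr x y z : x ≺ (y ≺ z) = - (x ≻ (y ≻ z)) - x ≺ (y ≻ z).
Proof. by rewrite -prec_dotE /dot linearDr addrAC subrr add0r. Qed.

Let distribE :=
  (linearDl succ, linearDr succ, linearNl succ, linearNr succ,
   linearDl prec, linearDr prec, linearNl prec, linearNr prec).

(* Rewrites every triple product into x ≻ (y ≻ z), (x ≻ y) ≻ z, x ≻ (y ≺ z)   *)
(* and x ≺ (y ≻ z), among which the axioms leave no relation.                 *)
Let triple_normal := (distribE, prec_precl, succ_precA, prec_succl, prec_precr).

Let scalE (zeta : {scalar A}) :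
  {morph zeta : u v / u + v} * {morph zeta : u / - u}.
Proof. by split; [exact: linearD | exact: linearN]. Qed.

(** * The compatibility conditions (1)-(6) *)

Lemma coproductE (zeta eta : {scalar A}) (x : A) :
  (contract (fun u v => zeta u * eta v) (Dsucc_r succ prec r x)
   = contract (fun u v => zeta (- (u ≺ x)) * eta v
                          + zeta u * eta (- (x ∙ v))) r) *
  (contract (fun u v => zeta u * eta v) (Dprec_r succ prec r x)
   = contract (fun u v => zeta (u ∙ x) * eta v + zeta u * eta (x ≻ v)) r).
Proof.
have lze : biscalar_form (fun u v => zeta u * eta v).
  by split=> *; rewrite linearP /=; ring.
split; rewrite /Dsucc_r /Dprec_r ?contract_tensN contract_tensD
  !contract_tmap //.
  rewrite contractD contractN; apply: eq_contract => u v.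
  by rewrite !linearN /Rop /Lop /=; ring.
by rewrite contractD.
Qed.

Local Notation Ds := (Dsucc_r succ prec r).
Local Notation Dp := (Dprec_r succ prec r).
Local Notation I := (idfun : A -> A).

Ltac solve_form :=
  split=> *; rewrite /Rop /Lop /= ?(linearPl, linearPr, linearP) /=; ring.

Ltac push_contract :=
  rewrite /Dsucc_r /Dprec_r ?contract_tens0;
  repeat (rewrite ?(contract_tensD, contract_tensN)
                  ?(contract_tmap, contract_tflip);
    try by solve_form);
  repeat rewrite ?contractN ?contractD.

Ltac triple_ring :=
  rewrite /Rop /Lop /dot /= ?triple_normal ?scalE; ring.

Lemma coproduct_mul x y :
  [/\ Dp (x ∙ y)
        = (Rop (dot succ prec) y \otf I) (Dp x) - (I \otf Lop succ x) (Dp y),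
      Ds (x ∙ y)
        = (I \otf Lop (dot succ prec) x) (Ds y) - (Rop prec y \otf I) (Ds x),
      Ds (x ≺ y) + Dp (x ≺ y)
        = (Rop prec y \otf I) (Ds x + Dp x) - (I \otf Lop prec x) (Ds y)
    & Ds (x ≻ y) + Dp (x ≻ y)
        = (I \otf Lop succ x) (Ds y + Dp y) - (Rop succ y \otf I) (Dp x)].
Proof.
split; apply: eq_tensor => zeta eta; push_contract;
  apply: eq_contract => u v; triple_ring.
Qed.

(** The left side of (5) is (L_≻(x) ⊗ I - I ⊗ R_≺(x)) (R_≻(y) ⊗ I - I ⊗ L_≺(y)) s, and that of (6)
    is - (I ⊗ R_∙(y) + L_≻(y) ⊗ I) (R_≺(x) ⊗ I + I ⊗ L_∙(x)) s; the inner factor kills s. *)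
Lemma coproduct_flip x y :
  (Lop succ x \otf I) (Ds y + Dp y) + (Rop succ y \otf I) (tflip (Ds x))
    - (I \otf Lop prec y) (tflip (Dp x)) - (I \otf Rop prec x) (Ds y + Dp y)
    = 0 /\
  (I \otf Rop (dot succ prec) y) (Ds x) + (Lop succ y \otf I) (Ds x)
    - tflip ((I \otf Rop prec x) (Dp y))
    - tflip ((Lop (dot succ prec) x \otf I) (Dp y))
    = 0.
Proof.
split; apply: eq_tensor => zeta eta; push_contract.
  have inv1 := @invariant_prec (fun u v => zeta (x ≻ u) * eta v) y.
  have inv2 := @invariant_prec (fun u v => zeta u * eta (v ≺ x)) y.
  (* Each zero is rewritten backwards into an invariance identity, so that both sides become
     contractions of r that agree pointwise. *)
  apply: etrans (_ : _ = 0 - 0) _; last by rewrite subr0.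
  rewrite -[X in _ = X - _]inv1 -?[X in _ = _ - X]inv2; try by solve_form.
  by rewrite contractN contractD; apply: eq_contract => u v; triple_ring.
have inv1 := @invariant_dot (fun u v => zeta u * eta (v ∙ y)) x.
have inv2 := @invariant_dot (fun u v => zeta (y ≻ u) * eta v) x.
apply: etrans (_ : _ = - 0 - 0) _; last by rewrite subr0 oppr0.
rewrite -[X in _ = - X - _]inv1 -?[X in _ = _ - X]inv2; try by solve_form.
by rewrite !contractN contractD; apply: eq_contract => u v; triple_ring.
Qed.

Lemma coproduct_linear : linear Ds /\ linear Dp.
Proof.
split=> c x y; apply: eq_tensor => zeta eta;
  rewrite [RHS]contract_tensD contract_tensZ;
  rewrite !coproductE contractZ contractD; apply: eq_contract => u v;
  rewrite ?(linearPl, linearPr) ?linearN ?linearP; ring.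
Qed.

(** * The operations on the dual and their composites *)

Lemma dual_succE zeta eta x : scal (dual_op Ds zeta eta) x
  = contract (fun u v => scal zeta (- (u ≺ x)) * scal eta v
                         + scal zeta u * scal eta (- (x ∙ v))) r.
Proof.
rewrite -(coproductE _ _ x).1 /scal dual_opE //.
by case: coproduct_linear.
Qed.

Lemma dual_precE zeta eta x : scal (dual_op Dp zeta eta) x
  = contract (fun u v => scal zeta (u ∙ x) * scal eta v
                         + scal zeta u * scal eta (x ≻ v)) r.
Proof.
rewrite -(coproductE _ _ x).2 /scal dual_opE //.
by case: coproduct_linear.
Qed.

Lemma dual_dotE zeta eta x : scal (dot (dual_op Ds) (dual_op Dp) zeta eta) x
  = contract (fun u v => scal zeta (u ≻ x) * scal eta v
                         + scal zeta u * scal eta (- (x ≺ v))) r.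
Proof.
transitivity (scal (dual_op Ds zeta eta) x + scal (dual_op Dp zeta eta) x).
  by rewrite {1}/scal /dot lfunE.
rewrite dual_succE dual_precE contractD; apply: eq_contract => u v.
rewrite /dot !scalE; ring.
Qed.

Lemma scalN (zeta : dual_space A) x : scal (- zeta) x = - scal zeta x.
Proof. by rewrite {1}/scal lfunE. Qed.

Section Composite.
Variables (f g f' g' : A -> A -> A) (zeta eta theta d : {scalar A}).

(** Here [d] is a product of [eta] and [theta] in the dual. The outer coproduct supplies the copy
    (a, b) of r, the inner one (a', b'). All three dual products have this shape, with signs
    absorbed into [f] and [g]. *)
Lemma composite_right x :
  (forall y, d y = contract (fun u v => eta (f' u y) * theta v
                                       + eta u * theta (g' y v)) r) ->
  contract (fun u v => zeta (f u x) * d v + zeta u * d (g x v)) r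
  = contract2 (fun a b a' b' =>
      zeta (f a x) * (eta (f' a' b) * theta b' + eta a' * theta (g' b b'))
      + zeta a * (eta (f' a' (g x b)) * theta b'
                  + eta a' * theta (g' (g x b) b'))) r.
Proof.
move=> dE; apply: eq_contract => a b; rewrite !dE !contractZ contractD.
exact: eq_contract.
Qed.

Lemma composite_left x :
  (forall y, d y = contract (fun u v => zeta (f' u y) * eta v
                                       + zeta u * eta (g' y v)) r) ->
  contract (fun u v => d (f u x) * theta v + d u * theta (g x v)) r
  = contract2 (fun a b a' b' =>
      (zeta (f' a' (f a x)) * eta b' + zeta a' * eta (g' (f a x) b')) * theta b
      + (zeta (f' a' a) * eta b' + zeta a' * eta (g' a b')) * theta (g x b)) r.
Proof.
move=> dE; apply: eq_contract => a b; rewrite !dE.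
rewrite -!(mulrC (theta _)) !contractZ contractD.
by apply: eq_contract => u v; ring.
Qed.
End Composite.

Lemma eq_dual (z z' : dual_space A) : scal z =1 scal z' -> z = z'.
Proof. by move=> e; apply/lfunP => x; apply: e. Qed.

Lemma scalP c (z z' : dual_space A) x :
  scal (c *: z + z') x = c * scal z x + scal z' x.
Proof. by rewrite {1}/scal !lfunE /= lfunE. Qed.

(** * The anti-dendriform axioms on the dual *)

Section DualIdentities.
Variables (zeta eta theta : dual_space A) (x : A).
Let z : {scalar A} := scal zeta.
Let e : {scalar A} := scal eta.
Let t : {scalar A} := scal theta.

Ltac solve_tri := split=> *; rewrite ?(linearPl, linearPr, linearP) /=; ring.

(** Left minus right is R_≺(x) on the first factor plus L_∙(x) on the third, applied to
    [ybe_rot]. *)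
Lemma dual_succ_succ :
  scal (dual_op Ds zeta (dual_op Ds eta theta)) x
  = - scal (dual_op Ds (dot (dual_op Ds) (dual_op Dp) zeta eta) theta) x.
Proof.
rewrite !dual_succE.
rewrite (composite_right (fun u x => - (u ≺ x)) (fun x u => - (x ∙ u)) _ _
  (dual_succE eta theta)).
rewrite (composite_left (fun u x => - (u ≺ x)) (fun x u => - (x ∙ u)) _ _
  (dual_dotE zeta eta)).
pose F p q s := z (p ≺ x) * e q * t s + z p * e q * t (x ∙ s).
have Y : contract2 (fun a b a' b' =>
    F a (a' ≺ b) b' + F a a' (b ∙ b') - F (a' ≻ a) b' b) r = 0.
  by apply: ybe_rot; rewrite /F; solve_tri.
rewrite -[RHS]addr0 -[X in _ = _ + X]Y contract2N contract2D.
pose K a b a' b' :=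
  z a' * e (a ≻ (x ≻ b')) * t b + z a' * e (a ≺ b') * t (x ∙ b).
apply: (@eq_contract2 _ _ _ _ K) => a b a' b'; rewrite /K /F /z /e /t.
triple_ring.
Qed.

(** Two equations enter: left minus right is R_∙(x) on the first factor of [ybe] minus L_∙(x) on the
    third factor of [ybe_rot]. *)
Lemma dual_dot_succ_prec_dot :
  - scal (dual_op Ds (dot (dual_op Ds) (dual_op Dp) zeta eta) theta) x
  = - scal (dual_op Dp zeta (dot (dual_op Ds) (dual_op Dp) eta theta)) x.
Proof.
rewrite dual_succE dual_precE.
rewrite (composite_left (fun u x => - (u ≺ x)) (fun x u => - (x ∙ u)) _ _
  (dual_dotE zeta eta)).
rewrite (composite_right (fun u x => u ∙ x) (fun x u => x ≻ u) _ _
  (dual_dotE eta theta)).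
pose F1 p q s := z (p ∙ x) * e q * t s.
pose F2 p q s := z p * e q * t (x ∙ s).
have Y1 : contract2 (fun a b a' b' =>
    F1 (a ∙ a') b b' + F1 a' (a ≻ b') b - F1 a a' (b ≺ b')) r = 0.
  by apply: ybe; rewrite /F1; solve_tri.
have Y2 : contract2 (fun a b a' b' =>
    F2 a (a' ≺ b) b' + F2 a a' (b ∙ b') - F2 (a' ≻ a) b' b) r = 0.
  by apply: ybe_rot; rewrite /F2; solve_tri.
rewrite -[RHS]addr0 -[X in _ = _ + X]Y1 -[RHS]subr0 -[X in _ = _ - X]Y2.
rewrite !contract2N !contract2D.
pose K a b a' b' :=
  z a * e (a' ≻ (x ≻ b)) * t b' - z ((a ∙ a') ∙ x) * e b * t b'
  + z a * e (a' ≺ b) * t (x ∙ b') + z (a ∙ x) * e (a' ≻ b) * t b'.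
apply: (@eq_contract2 _ _ _ _ K) => a b a' b'; rewrite /K /F1 /F2 /z /e /t.
triple_ring.
Qed.

(** Right minus left is R_∙(x) on the first factor plus L_≻(x) on the third, applied to [ybe]. *)
Lemma dual_prec_prec :
  - scal (dual_op Dp zeta (dot (dual_op Ds) (dual_op Dp) eta theta)) x
  = scal (dual_op Dp (dual_op Dp zeta eta) theta) x.
Proof.
rewrite !dual_precE.
rewrite (composite_right (fun u x => u ∙ x) (fun x u => x ≻ u) _ _
  (dual_dotE eta theta)).
rewrite (composite_left (fun u x => u ∙ x) (fun x u => x ≻ u) _ _
  (dual_precE zeta eta)).
pose F p q s := z (p ∙ x) * e q * t s + z p * e q * t (x ≻ s).
have Y : contract2 (fun a b a' b' =>
    F (a ∙ a') b b' + F a' (a ≻ b') b - F a a' (b ≺ b')) r = 0.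
  by apply: ybe; rewrite /F; solve_tri.
rewrite -[RHS]subr0 -[X in _ = _ - X]Y !contract2N contract2D.
pose K a b a' b' :=
  z ((a ∙ a') ∙ x) * e b * t b' + z a' * e (a ≻ (x ≻ b')) * t b
  + z (a ∙ a') * e b * t (x ≻ b') - z (a ∙ x) * e (a' ≻ b) * t b'.
apply: (@eq_contract2 _ _ _ _ K) => a b a' b'; rewrite /K /F /z /e /t.
triple_ring.
Qed.

(** Left minus right is R_≺(x) on the first factor minus L_≻(x) on the third, applied to
    [ybe_rot2]. *)
Lemma dual_succ_prec :
  scal (dual_op Dp (dual_op Ds zeta eta) theta) x
  = scal (dual_op Ds zeta (dual_op Dp eta theta)) x.
Proof.
rewrite dual_succE dual_precE.
rewrite (composite_left (fun u x => u ∙ x) (fun x u => x ≻ u) _ _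
  (dual_succE zeta eta)).
rewrite (composite_right (fun u x => - (u ≺ x)) (fun x u => - (x ∙ u)) _ _
  (dual_precE eta theta)).
pose F p q s := z (p ≺ x) * e q * t s - z p * e q * t (x ≻ s).
have Y : contract2 (fun a b a' b' =>
    F (a ≺ a') b b' + F a' (a ∙ b') b + F a a' (b ≻ b')) r = 0.
  by apply: ybe_rot2; rewrite /F; solve_tri.
rewrite -[RHS]addr0 -[X in _ = _ + X]Y contract2D.
pose K a b a' b' :=
  z a * e ((a' ∙ x) ∙ b) * t b' - z (a ≻ (a' ≻ x)) * e b * t b'
  + z (a ≺ a') * e b * t (x ≻ b') + z (a ≺ x) * e (a' ∙ b) * t b'.
apply: (@eq_contract2 _ _ _ _ K) => a b a' b'; rewrite /K /F /z /e /t.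
triple_ring.
Qed.
End DualIdentities.

Lemma dual_anti_dendriform : anti_dendriform_algebra (dual_op Ds) (dual_op Dp).
Proof.
split.
- split=> [u c y y' | y c u u']; apply: eq_dual => x /=;
  rewrite scalP !dual_succE contractZ contractD; apply: eq_contract => v w;
  rewrite !scalP; ring.
- split=> [u c y y' | y c u u']; apply: eq_dual => x /=;
  rewrite scalP !dual_precE contractZ contractD; apply: eq_contract => v w;
  rewrite !scalP; ring.
- move=> u v w; apply: eq_dual => x; rewrite scalN; exact: dual_succ_succ.
- move=> u v w; apply: eq_dual => x; rewrite !scalN.
  exact: dual_dot_succ_prec_dot.
- move=> u v w; apply: eq_dual => x; rewrite scalN; exact: dual_prec_prec.
- move=> u v w; apply: eq_dual => x; exact: dual_succ_prec.
Qed.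

Lemma coboundary_bialgebra : anti_dendriform_bialgebra succ prec Ds Dp.
Proof.
have [lDs lDp] := coproduct_linear.
split=> //; first by split=> //; apply: dual_anti_dendriform.
by move=> I' mul D x y; split; [apply: coproduct_mul | apply: coproduct_flip].
Qed.
End Coboundary.

Unset Implicit Arguments.

Theorem theorem3p5 (k : fieldType) (A : vectType k) (succ prec : A -> A -> A)
    (hA : anti_dendriform_algebra succ prec) (r : A \ot A)
    (hr : AD_YBE succ prec r) (hinv : ad_invariant succ prec (r + tflip r)) :
  anti_dendriform_bialgebra succ prec
    (Dsucc_r succ prec r) (Dprec_r succ prec r).
Proof.
have [bs bp _ _ _ _] := hA.
(* The operations are bundled with their bilinearity, the form in which the preceding section takes
   them. *)
pose s : {bilinear A -> A -> A} :=
  HB.pack succ (bilinear_isBilinear.Build k A A A *:%R *:%R succ bs).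
pose p : {bilinear A -> A -> A} :=
  HB.pack prec (bilinear_isBilinear.Build k A A A *:%R *:%R prec bp).
exact: (@coboundary_bialgebra k A s p hA r hr hinv).
Qed.
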